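(* Let a prior network with boundary conditions, positive weights $d_{kl}$ and a material amount $K>0$ be given, and suppose $\mathcal F\neq\emptyset$. Let $(\kappa_{kl})$ be a physical network with $\sum_{k>l,\langle k,l\rangle=1}\kappa_{kl}^{1/2}d_{kl}=K$ that globally minimizes the dissipation $$D=\sum_{k>l,\langle k,l\rangle=1}\frac{Q_{kl}^2}{\kappa_{kl}}$$ among all physical networks satisfying this material constraint, where $Q_{kl}$ denotes the Kirchhoff flow of the network. Then: (i) (Murray's law) there is a constant $a>0$ such that $\kappa_{kl}=a\,|Q_{kl}|^{4/3}/d_{kl}^{2/3}$ for all $\langle k,l\rangle=1$; (ii) there are no loops, i.e. there is at most one path between any pair of distinct vertices; (iii) no pair of distinct pressure vertices is connected by a path.
   Context: Prior network: a finite simple undirected graph on vertices $1,\dots,V$ with at least one edge; $\langle k,l\rangle=1$ means $k,l$ are joined by an edge ($\langle k,l\rangle=\langle l,k\rangle$), and $\langle k,l\rangle=0$ otherwise. Each edge carries a fixed weight $d_{kl}=d_{lk}>0$. Boundary conditions: disjoint vertex sets $\mathcal P$ (pressure vertices, each with prescribed pressure $\bar p_k\in\mathbb R$) and $\mathcal F$ (flow vertices, each with prescribed inflow $q_k\in\mathbb R$, $q_k\neq 0$; vertices with zero prescribed inflow are by convention not in $\mathcal F$). Put $q_k=0$ for $k\notin\mathcal P\cup\mathcal F$. A network is a choice of conductances $\kappa_{kl}=\kappa_{lk}\ge 0$ on the edges. A Kirchhoff flow is $Q_{kl}=(p_k-p_l)\kappa_{kl}$ on the edges (so $Q_{kl}=-Q_{lk}$),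 where the pressures $p_k$ satisfy $p_k=\bar p_k$ for $k\in\mathcal P$ and $\sum_{l:\langle k,l\rangle=1}(p_k-p_l)\kappa_{kl}=q_k$ for $k\notin\mathcal P$. The network is physical if there is exactly one Kirchhoff flow (equivalently, every connected component of the subgraph of edges with $\kappa_{kl}>0$ contains a vertex of $\mathcal P$ or has total prescribed inflow zero). Convention: a term $Q_{kl}^2/\kappa_{kl}$ with $\kappa_{kl}=0$ and $Q_{kl}=0$ is $0$. A path between vertices $k$ and $l$ is a sequence of pairwise distinct vertices $k=k_1,k_2,\dots,k_n=l$ with $\langle k_i,k_{i+1}\rangle=1$ and $\kappa_{k_ik_{i+1}}>0$ for all $1\le i\le n-1$. *)

(* Defs.v *)
From HB Require Import structures.
From mathcomp Require Import all_boot all_order all_algebra.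
From mathcomp Require Import reals exp.
Set Implicit Arguments.
Unset Strict Implicit.
Unset Printing Implicit Defensive.
Import Order.TTheory GRing.Theory Num.Theory.
Local Open Scope ring_scope.

(* Quantities attached to the edges (weights, conductances, flows) are V x V
   matrices of which only the entries at pairs with [adj k l] are meaningful. *)

Record prior_network (R : realType) (V : nat) := PriorNetwork {
  adj : rel 'I_V;
  adj_sym : symmetric adj;
  adj_irr : irreflexive adj;
  adj_edge : exists k l, adj k l;
  weight : 'M[R]_V;
  weight_sym : forall k l, adj k l -> weight k l = weight l k;
  weight_gt0 : forall k l, adj k l -> 0 < weight k l
}.

(* The values of [pbar] off [pvert] and of [inflow] on [pvert] are never used. *)
Record boundary_conditions (R : realType) (V : nat) := BoundaryConditions {
  pvert : {set 'I_V};
  fvert : {set 'I_V};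
  pf_disjoint : [disjoint pvert & fvert];
  pbar : 'I_V -> R;
  inflow : 'I_V -> R;
  inflow_neq0 : forall k, k \in fvert -> inflow k != 0;
  inflow_eq0 : forall k, k \notin pvert :|: fvert -> inflow k = 0
}.

Section Network.
Variables (R : realType) (V : nat).
Variables (N : prior_network R V) (B : boundary_conditions R V).
Implicit Types (kappa Q : 'M[R]_V) (p : 'I_V -> R).

Definition conductances kappa : Prop :=
  forall k l, adj N k l -> 0 <= kappa k l /\ kappa k l = kappa l k.

Definition kirchhoff_pressures kappa p : Prop :=
  (forall k, k \in pvert B -> p k = pbar B k) /\
  (forall k, k \notin pvert B ->
     \sum_(l < V | adj N k l) (p k - p l) * kappa k l = inflow B k).

(* Flows are extended by 0 to the non-edges, so that Leibniz equality of
   matrices is equality of flows on the edges. *)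
Definition kirchhoff_flow kappa Q : Prop :=
  exists2 p, kirchhoff_pressures kappa p &
    Q = \matrix_(k, l) (if adj N k l then (p k - p l) * kappa k l else 0).

Definition physical kappa : Prop :=
  conductances kappa /\ (exists! Q, kirchhoff_flow kappa Q).

Definition material kappa : R :=
  \sum_(k < V) \sum_(l < V | (l < k)%N && adj N k l)
    Num.sqrt (kappa k l) * weight N k l.

(* Since [x / 0 = 0], a term with [Q k l = kappa k l = 0] is 0; for a Kirchhoff
   flow, [kappa k l = 0] forces [Q k l = 0]. *)
Definition dissipation kappa Q : R :=
  \sum_(k < V) \sum_(l < V | (l < k)%N && adj N k l)
    Q k l ^+ 2 / kappa k l.

Definition minimizes_dissipation (K : R) kappa Q : Prop :=
  [/\ physical kappa, kirchhoff_flow kappa Q, material kappa = K &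
    forall kappa' Q', physical kappa' -> kirchhoff_flow kappa' Q' ->
      material kappa' = K -> dissipation kappa Q <= dissipation kappa' Q'].

Definition conducting kappa : rel 'I_V :=
  fun k l => adj N k l && (0 < kappa k l).

(* The vertex sequence of the path is [k :: s]. *)
Definition is_path kappa (k l : 'I_V) (s : seq 'I_V) : bool :=
  [&& path (conducting kappa) k s, uniq (k :: s) & last k s == l].

End Network.

(* Main.v *)
(* By Hoelder, a flow Q satisfying the boundary conditions dissipates at least
   S(Q)^3 / K^2, where S(Q) is the sum of |Q d|^(2/3), with equality exactly for
   conductances obeying Murray's law. Merge the pressure vertices into one. If
   the support of Q carries a circulation C, then concavity of x^(2/3) shows
   that moving Q along C or - C until an edge flow vanishes strictly decreases
   S; repeating this ends at a loop-free Q'. As the pressures can be integrated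
   along a loop-free support whatever values are prescribed on the pressure
   vertices, the Murray network of Q' is physical with flow Q'. Hence a minimizer
   attains equality in Hoelder, and its own flow is already loop-free: a second
   path between two vertices, or a path between two pressure vertices, would give
   a circulation. *)
Require Import Defs.
From mathcomp Require Import all_boot all_order all_algebra.
From mathcomp Require Import ring lra.
From mathcomp Require Import boolp reals exp.
Import Order.TTheory GRing.Theory Num.Theory.
Local Open Scope ring_scope.

(** * Cube roots and the strict tangent inequality for $|x|^{2/3}$ *)

Section RealInequalities.
Context {R : realType}.
Implicit Types x u w : R.

(** Cube root of the absolute value. The fractional powers that occur are natural powers of it,
    which brings them within reach of [ring] and [field]. *)
Definition cbrt x : R := `|x| `^ 3%:R^-1.

Lemma cbrt_ge0 x : 0 <= cbrt x.
Proof. exact: powR_ge0. Qed.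

Lemma powR_cbrt x n : `|x| `^ (n%:R / 3%:R) = cbrt x ^+ n.
Proof. by rewrite mulrC powRrM powR_mulrn ?powR_ge0. Qed.

Lemma cbrtK x : cbrt x ^+ 3 = `|x|.
Proof. by rewrite -powR_cbrt divff ?pnatr_eq0// powRr1. Qed.

Lemma sqr_cbrt x : x ^+ 2 = cbrt x ^+ 6.
Proof. by rewrite (exprM _ 3 2) cbrtK real_normK ?num_real. Qed.

Lemma cbrtN x : cbrt (- x) = cbrt x.
Proof. by rewrite /cbrt normrN. Qed.

Lemma cbrt_eq0 x : (cbrt x == 0) = (x == 0).
Proof. by rewrite -[RHS]normr_eq0 -cbrtK expf_eq0. Qed.

Lemma cbrt0 : cbrt 0 = 0.
Proof. by apply/eqP; rewrite cbrt_eq0. Qed.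

Lemma cbrt_gt0 x : (0 < cbrt x) = (x != 0).
Proof. by rewrite lt_def cbrt_ge0 andbT cbrt_eq0. Qed.

(** AM-GM for $u^3, w^3, w^3$. It serves twice: for the concavity of $x^{2/3}$ and for Young's
    inequality on each edge. *)
Lemma cubic_tangent u w : 0 <= u -> 0 <= w ->
  3%:R * (u * w ^+ 2) <= u ^+ 3 + 2%:R * w ^+ 3.
Proof.
move=> u0 w0; rewrite -subr_ge0.
have -> : u ^+ 3 + 2%:R * w ^+ 3 - 3%:R * (u * w ^+ 2)
  = (u - w) ^+ 2 * (u + 2%:R * w) by ring.
by rewrite mulr_ge0 ?sqr_ge0//; lra.
Qed.

Lemma cubic_tangent_eq u w : 0 <= u -> 0 <= w ->
  3%:R * (u * w ^+ 2) = u ^+ 3 + 2%:R * w ^+ 3 -> u = w.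
Proof.
move=> u0 w0 /eqP; rewrite eq_sym -subr_eq0.
have -> : u ^+ 3 + 2%:R * w ^+ 3 - 3%:R * (u * w ^+ 2)
  = (u - w) ^+ 2 * (u + 2%:R * w) by ring.
rewrite mulf_eq0 expf_eq0 subr_eq0 /= => /orP[/eqP//|/eqP uw].
lra.
Qed.

(** The slope of $x^{2/3}$ at $|x|$ is $\frac23 |x|^{-1/3}$; the gap below this tangent is the AM-GM
    gap for the two cube roots, up to a positive factor. *)
Lemma cbrt_sqr_tangentE x y : x != 0 ->
  cbrt x ^+ 2 + 2%:R / 3%:R / cbrt x * (`|y| - `|x|) - cbrt y ^+ 2 =
  (cbrt x ^+ 3 + 2%:R * cbrt y ^+ 3 - 3%:R * (cbrt x * cbrt y ^+ 2)) /
    (3%:R * cbrt x).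
Proof. by move=> x0; rewrite -!cbrtK; field; rewrite cbrt_eq0. Qed.

Lemma cbrt_sqr_tangent x y : x != 0 ->
  cbrt y ^+ 2 <= cbrt x ^+ 2 + 2%:R / 3%:R / cbrt x * (`|y| - `|x|).
Proof.
move=> x0; rewrite -subr_ge0 cbrt_sqr_tangentE // divr_ge0 //.
  by rewrite subr_ge0 cubic_tangent ?cbrt_ge0.
by rewrite mulr_ge0 ?cbrt_ge0.
Qed.

Lemma cbrt_sqr_tangent_lt x y : x != 0 -> `|y| != `|x| ->
  cbrt y ^+ 2 < cbrt x ^+ 2 + 2%:R / 3%:R / cbrt x * (`|y| - `|x|).
Proof.
move=> x0 xy; rewrite lt_neqAle cbrt_sqr_tangent // andbT.
apply: contra_neq xy => /esym /eqP.
rewrite -subr_eq0 cbrt_sqr_tangentE // mulf_eq0 invr_eq0 mulf_eq0 pnatr_eq0 /=.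
rewrite cbrt_eq0 (negPf x0) orbF subr_eq0 => /eqP /esym.
by move=> /cubic_tangent_eq h; rewrite -!cbrtK h ?cbrt_ge0.
Qed.

End RealInequalities.

(** * Solvability of linear systems over finite types *)

Lemma sum_enum_val {F : fieldType} {T : finType} (f : T -> F) :
  \sum_t f t = \sum_(j < #|T|) f (enum_val j).
Proof.
by apply: reindex; exists enum_rank => x _; rewrite ?enum_valK ?enum_rankK.
Qed.

(** The hypothesis applied to the columns of the cokernel of the matrix of [a] places [b] in its row
    space. *)
Lemma fredholm_alternative {F : fieldType} {I T : finType}
    (a : I -> T -> F) (b : T -> F) :
  (forall c : T -> F, (forall i, \sum_t a i t * c t = 0) ->
    \sum_t b t * c t = 0) ->
  exists u : I -> F, forall t, b t = \sum_i u i * a i t.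
Proof.
move=> h.
pose A : 'M[F]_(#|I|, #|T|) := \matrix_(i, j) a (enum_val i) (enum_val j).
pose bv : 'rV[F]_#|T| := \row_j b (enum_val j).
have /submxP[u ub] : (bv <= A)%MS.
  rewrite submxE; apply/eqP/rowP => j; rewrite [LHS]mxE [RHS]mxE.
  apply: etrans (h (fun t => cokermx A (enum_rank t) j) _) => [|i].
    by rewrite [RHS]sum_enum_val; apply: eq_bigr => k _; rewrite mxE enum_valK.
  have /matrixP /(_ (enum_rank i) j) := mulmx_coker A.
  rewrite [LHS]mxE [RHS]mxE => /(etrans _); apply; rewrite [LHS]sum_enum_val.
  by apply: eq_bigr => k _; rewrite [A _ _]mxE enum_rankK enum_valK.
exists (fun i => u 0 (enum_rank i)) => t.
have /rowP /(_ (enum_rank t)) := ub.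
rewrite [LHS]mxE [RHS]mxE enum_rankK => ->.
rewrite [RHS]sum_enum_val.
by apply: eq_bigr => i _; rewrite mxE enum_rankK enum_valK.
Qed.

(** * Circulations, transport cost and reduction to loop-free flows *)

Section Flows.
Context {R : realType} {V : nat}.
Variables (N : prior_network R V) (B : boundary_conditions R V).
Implicit Types (X Q C kappa : 'M[R]_V) (q : 'I_V -> R).

(* The inflow is prescribed only off the pressure vertices, as if these were
   merged into a single grounded vertex. *)
Definition conserves q X : Prop :=
  [/\ forall k l, X l k = - X k l,
      forall k l, X k l != 0 -> adj N k l &
      forall k, k \notin pvert B -> \sum_l X k l = q k].

Definition circulation_on Q C : Prop :=
  conserves (fun=> 0) C /\ forall k l, C k l != 0 -> Q k l != 0.

(** Circulations need not balance at pressure vertices, so this rules out paths in the support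
    joining two pressure vertices as well as cycles. *)
Definition loop_free Q : Prop := forall C, circulation_on Q C -> C = 0.

Definition edge (e : 'I_V * 'I_V) : bool := (e.2 < e.1)%N && adj N e.1 e.2.

Definition transport_cost Q : R :=
  \sum_(e | edge e) (cbrt (Q e.1 e.2) * cbrt (weight N e.1 e.2)) ^+ 2.

(** This is $c^2 |Q|^{4/3} / d^{2/3}$, written as a square because the material involves its square
    root. *)
Definition murray (c : R) Q : 'M[R]_V :=
  \matrix_(k, l) (c * cbrt (Q k l) ^+ 2 / cbrt (weight N k l)) ^+ 2.

Lemma edge_sumE (f : 'I_V -> 'I_V -> R) :
  \sum_(k < V) \sum_(l < V | (l < k)%N && adj N k l) f k l =
  \sum_(e | edge e) f e.1 e.2.
Proof. by rewrite pair_big_dep. Qed.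

Lemma conserves_diag q X k : conserves q X -> X k k = 0.
Proof. by move=> [a _ _]; have := a k k; lra. Qed.

Lemma conserves_neq0 q X : conserves q X -> X != 0 ->
  exists2 e, edge e & X e.1 e.2 != 0.
Proof.
move=> Xc X0; have [a s _] := Xc.
have [[k l] /= kl] : exists e : 'I_V * 'I_V, X e.1 e.2 != 0.
  apply: contrapT => h; move/eqP: X0; apply; apply/matrixP => k l.
  rewrite mxE; apply/eqP; apply: contrapT => /negP kl; apply: h.
  by exists (k, l).
case: (ltngtP k l) => [lt_kl|lt_lk|/ord_inj eq_kl].
- exists (l, k) => /=; last by rewrite a oppr_eq0.
  by rewrite /edge /= lt_kl s // a oppr_eq0.
- by exists (k, l); rewrite // /edge /= lt_lk s.
- by move: kl; rewrite eq_kl (conserves_diag q) ?eqxx.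
Qed.

Lemma conserves_lin q X C t : conserves q X -> conserves (fun=> 0) C ->
  conserves q (X + t *: C).
Proof.
move=> [aX sX dX] [aC sC dC]; split=> [k l|k l|k kP].
- by rewrite !mxE aX aC; ring.
- rewrite !mxE => h; case: (eqVneq (X k l) 0) => [x0|/sX//].
  by apply: sC; apply: contraNneq h => ->; rewrite x0 mulr0 addr0.
- under eq_bigr do rewrite !mxE.
  by rewrite big_split /= -mulr_sumr dX // dC // mulr0 addr0.
Qed.

Lemma circulation_onN Q C : circulation_on Q C -> circulation_on Q (- C).
Proof.
move=> [[a s d] sQ]; split; last by move=> k l; rewrite mxE oppr_eq0; exact: sQ.
split=> [k l|k l|k kP]; rewrite ?mxE; first by rewrite a.
- by rewrite oppr_eq0; exact: s.
- by under eq_bigr do rewrite mxE; rewrite sumrN d // oppr0.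
Qed.

Definition flow_support Q := [set e : 'I_V * 'I_V | Q e.1 e.2 != 0].

(* [x |-> |x| ^ (2/3)] lies below its tangents on each half-line, so moving
   along the circulation in the direction of nonpositive slope, until the first
   edge flow vanishes, decreases the cost. *)
Lemma cancel_circulation q Q C :
  conserves q Q -> circulation_on Q C -> C != 0 ->
  exists Q', [/\ conserves q Q', transport_cost Q' < transport_cost Q &
    (#|flow_support Q'| < #|flow_support Q|)%N].
Proof.
(* For [D] supported on [Q], two thirds of [slope D] is the derivative of the cost at [Q] along [D].
   It is odd in [D], so one of [C] and [- C] has nonpositive slope. *)
move=> Qc; pose slope D := \sum_(e | edge e)
  cbrt (weight N e.1 e.2) ^+ 2 / cbrt (Q e.1 e.2) *
  (Num.sg (Q e.1 e.2) * D e.1 e.2).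
wlog slope0 : C / slope C <= 0.
  move=> h cC C0; have [/h|slopeC] := leP (slope C) 0; first exact.
  apply: (h (- C)); rewrite ?oppr_eq0 //; last exact: circulation_onN.
  suff -> : slope (- C) = - slope C by rewrite oppr_le0 ltW.
  rewrite /slope -sumrN; apply: eq_bigr => e _; rewrite mxE; ring.
move=> [Cc CQ] C0.
have wgt0 e : edge e -> 0 < cbrt (weight N e.1 e.2).
  by case/andP=> _ /weight_gt0 w0; rewrite cbrt_gt0 gt_eqF.
(* Were [C] nowhere opposed to [Q], all terms of the slope would be nonnegative and one of them
   positive. *)
have [e0 e0C] : exists e : 'I_V * 'I_V, Q e.1 e.2 * C e.1 e.2 < 0.
  apply: contrapT => h.
  have sgC e : 0 <= Num.sg (Q e.1 e.2) * C e.1 e.2.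
    rewrite leNgt; apply/negP => sC; apply: h; exists e.
    by rewrite -sgr_cp0 sgrM -(sgr_id (Q _ _)) -sgrM sgr_cp0.
  have [e ee eC] := conserves_neq0 _ _ Cc C0.
  have eQ := CQ _ _ eC.
  suff : 0 < slope C by rewrite ltNge slope0.
  rewrite /slope (bigD1 e) //= ltr_wpDr ?sumr_ge0 //.
    by move=> i /andP[/wgt0 i0 _]; rewrite mulr_ge0 ?divr_ge0 ?sqr_ge0 ?cbrt_ge0.
  rewrite mulr_gt0 ?divr_gt0 ?exprn_gt0 ?wgt0 ?cbrt_gt0 // lt_def sgC andbT.
  by rewrite mulf_neq0 ?sgr_eq0.
(* [r e] is the time at which the flow on [e] vanishes; [e1] is the first edge opposed by [C] to
   reach it. *)
pose r e := - (Q e.1 e.2 / C e.1 e.2) : R.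
pose e1 := [arg min_(e < e0 | Q e.1 e.2 * C e.1 e.2 < 0) r e]%O.
have [e1C e1min] : Q e1.1 e1.2 * C e1.1 e1.2 < 0 /\
    forall e, Q e.1 e.2 * C e.1 e.2 < 0 -> r e1 <= r e.
  by rewrite /e1; case: arg_minP.
have e1C0 : C e1.1 e1.2 != 0.
  by apply: contraTneq e1C => ->; rewrite mulr0 ltxx.
set t := r e1 in e1min.
have t0 : 0 < t.
  have := e1C; rewrite /t /r; set x := Q _ _; set y := C _ _ in e1C0 * => xy.
  have -> : - (x / y) = - (x * y) / y ^+ 2 by field.
  by rewrite divr_gt0 ?oppr_gt0 // exprn_even_gt0.
pose Q' := Q + t *: C.
have Q'E k l : Q' k l = Q k l + t * C k l by rewrite !mxE.
have CQ0 k l : Q k l = 0 -> C k l = 0.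
  by move=> Q0; apply/eqP; apply: contraTT isT => /CQ; rewrite Q0 eqxx.
(* No edge flow changes sign up to time [t], so its absolute value varies linearly. *)
have normQ' k l : `|Q' k l| = `|Q k l| + t * (Num.sg (Q k l) * C k l).
  rewrite Q'E; have [Q0|Q0] := eqVneq (Q k l) 0.
    by rewrite Q0 (CQ0 _ _ Q0) !mulr0 addr0 normr0 addr0.
  have nn : 0 <= `|Q k l| + t * (Num.sg (Q k l) * C k l).
    have [sC|sC] := ltP (Q k l * C k l) 0; last first.
      rewrite addr_ge0 // mulr_ge0 ?(ltW t0) //.
      by rewrite -sgr_ge0 sgrM sgr_id -sgrM sgr_ge0.
    have := e1min (k, l) sC; rewrite /r /=.
    have kC : C k l != 0 by apply: contraTneq sC => ->; rewrite mulr0 ltxx.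
    move=> le_t.
    have sgC : Num.sg (Q k l) * C k l < 0.
      by rewrite -sgr_lt0 sgrM sgr_id -sgrM sgr_lt0.
    have := ler_wnM2r (ltW sgC) le_t.
    suff -> : - (Q k l / C k l) * (Num.sg (Q k l) * C k l) = - `|Q k l|.
      by lra.
    rewrite [`|Q k l|]normrEsg; field; exact: kC.
  rewrite -(ger0_norm nn); set z := _ + t * _ in nn *.
  have -> : Q k l + t * C k l = Num.sg (Q k l) * z.
    rewrite /z mulrDr -numEsg; congr (_ + _).
    have : Num.sg (Q k l) * Num.sg (Q k l) = 1 by rewrite -expr2 sqr_sg Q0.
    move=> s2; rewrite mulrCA !mulrA -[_ * Num.sg _ * Num.sg _]mulrA s2; ring.
  by rewrite normrM normr_sg Q0 mul1r.
exists Q'; split; first exact: conserves_lin.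
(* Equality on an edge forces [C] to vanish there; since [C] is nonzero, the summed inequality is
   strict. *)
- have tangent e : edge e ->
      (cbrt (Q' e.1 e.2) * cbrt (weight N e.1 e.2)) ^+ 2 <=
      (cbrt (Q e.1 e.2) * cbrt (weight N e.1 e.2)) ^+ 2 +
      2%:R / 3%:R * t * (cbrt (weight N e.1 e.2) ^+ 2 / cbrt (Q e.1 e.2) *
        (Num.sg (Q e.1 e.2) * C e.1 e.2)) ?= iff (C e.1 e.2 == 0).
    move=> /wgt0 w0; have [C1|C1] := eqVneq (C e.1 e.2) 0.
      by rewrite Q'E C1 !mulr0 !addr0; exact: leif_refl.
    have Q1 := CQ _ _ C1; apply/leifP.
    have := cbrt_sqr_tangent_lt _ (Q' e.1 e.2) Q1.
    rewrite normQ' addrAC subrr add0r => /(_ _)/wrap[].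
      rewrite -subr_eq0 addrAC subrr add0r.
      by rewrite !mulf_neq0 ?sgr_eq0 // gt_eqF.
    rewrite -(ltr_pM2r (exprn_gt0 2 w0)) -exprMn; congr (_ < _); ring.
  have [le_sum eq_sum] := leif_sum tangent.
  have : transport_cost Q' < transport_cost Q + 2%:R / 3%:R * t * slope C.
    rewrite /transport_cost /slope mulr_sumr -big_split /= lt_neqAle le_sum eq_sum.
    rewrite andbT; have [e ee eC] := conserves_neq0 _ _ Cc C0.
    by apply/forallP => /(_ e); rewrite ee (negPf eC).
  move=> /lt_le_trans; apply; rewrite gerDl mulr_ge0_le0 //.
  by rewrite mulr_ge0 ?divr_ge0 ?(ltW t0).
- apply: proper_card; apply/properP; split.
    apply/subsetP => e; rewrite !inE; apply: contraNneq => Q0.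
    by rewrite Q'E Q0 (CQ0 _ _ Q0) mulr0 addr0.
  exists e1; rewrite !inE; first exact: CQ.
  by rewrite negbK Q'E /t /r; apply/eqP; field.
Qed.

(** Each cancellation shrinks the support, so the process stops. The disjunction records whether any
    cancellation took place: if the cost did not drop, [Q] was loop-free from the start. *)
Lemma loop_free_reduction q Q : conserves q Q ->
  exists Q', [/\ conserves q Q', loop_free Q' &
    transport_cost Q' < transport_cost Q \/
    (transport_cost Q' = transport_cost Q /\ loop_free Q)].
Proof.
have [n] := ubnP (#|flow_support Q|); elim: n Q => // n IHn Q leQn Qc.
have [lfQ|] := pselect (loop_free Q); first by exists Q; split; [| |right].
move=> /existsNP[C] /not_implyP[cC /eqP C0].
have [Q1 [Q1c lt_cost lt_size]] := cancel_circulation _ _ _ Qc cC C0.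
have [|Q2 [Q2c lf2 cost2]] := IHn Q1 _ Q1c.
  by rewrite (leq_trans lt_size).
exists Q2; split=> //; left; case: cost2 => [|[->//]].
by move=> /lt_trans; apply.
Qed.

Lemma cbrt_weight_gt0 k l : adj N k l -> 0 < cbrt (weight N k l).
Proof. by move=> /weight_gt0 w0; rewrite cbrt_gt0 gt_eqF. Qed.

Lemma cbrt_weightK k l : adj N k l -> cbrt (weight N k l) ^+ 3 = weight N k l.
Proof. by move=> /weight_gt0 w0; rewrite cbrtK gtr0_norm. Qed.

(** A flow vertex has nonzero inflow and is not a pressure vertex, so some edge carries flow. This
    permits division by the cost. *)
Lemma transport_cost_gt0 Q : conserves (inflow B) Q -> fvert B != set0 ->
  0 < transport_cost Q.
Proof.
move=> Qc /set0Pn[f fF].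
have Q0 : Q != 0.
  apply: contraTneq (inflow_neq0 fF) => Q0; rewrite negbK.
  have [_ _ <-] := Qc; first by rewrite Q0 big1 // => l _; rewrite mxE.
  by apply/negP => /(disjointFr (pf_disjoint B)); rewrite fF.
have [e ee eQ] := conserves_neq0 _ _ Qc Q0.
rewrite /transport_cost (bigD1 e) //= ltr_wpDr ?sumr_ge0 //.
  by move=> i _; exact: sqr_ge0.
case/andP: ee => _ /cbrt_weight_gt0 w0.
by rewrite exprn_gt0 // mulr_gt0 // cbrt_gt0.
Qed.

Lemma kirchhoff_conserves kappa Q :
  conductances N kappa -> kirchhoff_flow N B kappa Q -> conserves (inflow B) Q.
Proof.
move=> cond [p [_ pk] ->]; split=> [k l|k l|k /pk <-].
- rewrite !mxE adj_sym; case: ifP => [kl|_]; last by rewrite oppr0.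
  by rewrite (cond _ _ kl).2; ring.
- by rewrite mxE; case: ifP; rewrite ?eqxx.
- by rewrite [RHS]big_mkcond; apply: eq_bigr => l _; rewrite mxE.
Qed.

(** * Murray networks: dissipation, optimality and physicality *)

Section Murray.
Variable c : R.
Hypothesis c0 : 0 < c.

Lemma murrayE Q k l :
  murray c Q k l = (c * cbrt (Q k l) ^+ 2 / cbrt (weight N k l)) ^+ 2.
Proof. by rewrite mxE. Qed.

Lemma murray_eq0 Q k l : Q k l = 0 -> murray c Q k l = 0.
Proof. by rewrite murrayE => ->; rewrite cbrt0 !(expr0n, mulr0, mul0r). Qed.

Lemma murray_neq0 Q k l : adj N k l -> (murray c Q k l != 0) = (Q k l != 0).
Proof.
move=> /cbrt_weight_gt0 w0.
rewrite murrayE expf_eq0 /= mulf_eq0 invr_eq0 (gt_eqF w0) orbF.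
by rewrite mulf_eq0 (gt_eqF c0) expf_eq0 cbrt_eq0.
Qed.

(** Determines the constant: for $c = K / S(Q)$ the material is $K$, and the dissipation $S(Q)/c^2$
    is then $S(Q)^3/K^2$. *)
Lemma murray_material Q : material N (murray c Q) = c * transport_cost Q.
Proof.
rewrite /material edge_sumE /transport_cost mulr_sumr.
apply: eq_bigr => e /andP[_ ee]; have w0 := cbrt_weight_gt0 _ _ ee.
rewrite -{1}(cbrt_weightK _ _ ee) murrayE sqrtr_sqr ger0_norm.
  by field; rewrite gt_eqF.
by rewrite divr_ge0 ?mulr_ge0 ?exprn_ge0 ?cbrt_ge0 ?(ltW c0).
Qed.

Lemma murray_dissipation Q :
  dissipation N (murray c Q) Q = transport_cost Q / c ^+ 2.
Proof.
rewrite /dissipation edge_sumE /transport_cost mulr_suml.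
apply: eq_bigr => e /andP[_ ee]; have w0 := cbrt_weight_gt0 _ _ ee.
rewrite murrayE sqr_cbrt; have [->|Q0] := eqVneq (Q e.1 e.2) 0.
  by rewrite cbrt0 mul0r !expr0n /= !mul0r.
by rewrite -cbrt_eq0 in Q0; field; rewrite Q0 (gt_eqF w0) (gt_eqF c0).
Qed.

(* Young's inequality [3 u w^2 <= u^3 + 2 w^3] on each edge, for
   [u = |Q|^(2/3)] and [w = d^(1/3) kappa^(1/2) / c]. *)
Lemma dissipation_bound_edge Q kappa k l : adj N k l -> 0 <= kappa k l ->
  (kappa k l = 0 -> Q k l = 0) ->
  3%:R / c ^+ 2 * (cbrt (Q k l) * cbrt (weight N k l)) ^+ 2 <=
  Q k l ^+ 2 / kappa k l +
    2%:R / c ^+ 3 * (Num.sqrt (kappa k l) * weight N k l)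
  ?= iff (kappa k l == murray c Q k l).
Proof.
move=> kl kap0 kapQ; have v0 := cbrt_weight_gt0 _ _ kl.
rewrite murrayE [Q k l ^+ 2]sqr_cbrt -{2}(cbrt_weightK _ _ kl) -{1 3}(sqr_sqrtr kap0).
set s := Num.sqrt _; set v := cbrt (weight _ _ _) in v0 *.
(* At zero conductance the flow vanishes too, so both sides are 0 and Murray's law holds
   trivially. *)
have [s0|s0] := eqVneq s 0.
  have -> : Q k l = 0.
    by apply: kapQ; rewrite -(sqr_sqrtr kap0) -/s s0 expr0n.
  rewrite s0 cbrt0 !(mul0r, mulr0, expr0n) /= addr0 eqxx.
  exact: leif_refl.
have sgt0 : 0 < s by rewrite lt_def s0 sqrtr_ge0.
have := cbrt_ge0 (Q k l); set t := cbrt _ => t0.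
have w0 : 0 <= v * s / c by rewrite !mulr_ge0 ?invr_ge0 ?ltW.
have u0 : 0 <= t ^+ 2 by rewrite sqr_ge0.
have lhsE : 3%:R / c ^+ 2 * (t * v) ^+ 2 =
  3%:R * (t ^+ 2 * (v * s / c) ^+ 2) / s ^+ 2.
  by field; rewrite !gt_eqF.
have rhsE : t ^+ 6 / s ^+ 2 + 2%:R / c ^+ 3 * (s * v ^+ 3) =
  ((t ^+ 2) ^+ 3 + 2%:R * (v * s / c) ^+ 3) / s ^+ 2.
  by field; rewrite !gt_eqF.
rewrite lhsE rhsE; split; first by rewrite ler_pM2r ?invr_gt0 ?exprn_gt0 ?cubic_tangent.
have inj : s ^- 2 != 0 by rewrite invr_eq0 expf_neq0.
(* Equality in Young means $u = w$, which solved for $s = \kappa^{1/2}$ is the square root of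
   Murray's law. *)
rewrite (inj_eq (mulIf inj)) eqrXn2 ?(ltW sgt0) //; last first.
  by rewrite divr_ge0 ?mulr_ge0 ?(ltW c0) ?(ltW v0).
apply/eqP/eqP => [/cubic_tangent_eq -> //|->].
  by field; rewrite !gt_eqF.
by field; rewrite !gt_eqF.
Qed.

(** Hoelder's inequality in linearized form: with $c = K/S(Q)$ and material $K$ it reads $S(Q)^3/K^2
    \le D$, and equality holds edge by edge. *)
Lemma dissipation_bound Q kappa : conductances N kappa ->
  (forall k l, adj N k l -> kappa k l = 0 -> Q k l = 0) ->
  3%:R / c ^+ 2 * transport_cost Q <=
  dissipation N kappa Q + 2%:R / c ^+ 3 * material N kappa
  ?= iff [forall (e | edge e), kappa e.1 e.2 == murray c Q e.1 e.2].
Proof.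
move=> cond kapQ; rewrite /dissipation /material !edge_sumE !mulr_sumr -big_split /=.
apply: leif_sum => e /andP[_ ee]; apply: dissipation_bound_edge => //.
  exact: (cond _ _ ee).1.
exact: kapQ.
Qed.

Lemma murray_conductances q Q : conserves q Q -> conductances N (murray c Q).
Proof.
move=> [a _ _] k l kl; rewrite !murrayE sqr_ge0; split=> //.
by rewrite a cbrtN (weight_sym kl).
Qed.

(* A linear relation among the equations [p k - p l = Q k l / kappa k l] and
   [p k = pbar k] is a circulation on [Q]; there is none. *)
Lemma loop_free_pressures q Q : conserves q Q -> loop_free Q ->
  exists p : 'I_V -> R, (forall k, k \in pvert B -> p k = pbar B k) /\
    forall k l, Q k l != 0 -> p k - p l = Q k l / murray c Q k l.
Proof.
move=> Qc lf; have [aQ sQ _] := Qc; have Qkk := conserves_diag _ _ ^~ Qc.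
pose kap := murray c Q.
have kap_sym k l : adj N k l -> kap k l = kap l k.
  by move=> /(murray_conductances _ _ Qc)[].
pose supp k l := (Q k l != 0)%:R : R.
have suppC k l : supp k l = supp l k by rewrite /supp aQ oppr_eq0.
(* [inl] indexes the pressure differences, switched off by [supp] outside the support of [Q]; [inr]
   indexes the prescribed pressures. *)
pose a i (e : 'I_V * 'I_V + 'I_V) : R := match e with
  | inl e => supp e.1 e.2 * ((i == e.1)%:R - (i == e.2)%:R)
  | inr k => (k \in pvert B)%:R * (i == k)%:R end.
pose b (e : 'I_V * 'I_V + 'I_V) : R := match e with
  | inl e => Q e.1 e.2 / kap e.1 e.2
  | inr k => (k \in pvert B)%:R * pbar B k end.
have [] := @fredholm_alternative R 'I_V ('I_V * 'I_V + 'I_V)%type a b.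
  move=> z za.
  pose C : 'M[R]_V := \matrix_(k, l) (supp k l * (z (inl (k, l)) - z (inl (l, k)))).
  (* The relation [z] read at vertex [i]: the net outflow of [C] cancels the multiplier of the
     pressure equation at [i], which is absent off [pvert B]. *)
  have divC i : \sum_l C i l + (i \in pvert B)%:R * z (inr i) = 0.
    rewrite -[RHS](za i) big_sumType /=; congr (_ + _); last first.
      rewrite [RHS](bigD1 i) //= [X in _ + X]big1 ?addr0 ?eqxx ?mulr1 // => k ki.
      by rewrite eq_sym (negPf ki) mulr0 mul0r.
    transitivity (\sum_k \sum_l
        supp k l * ((i == k)%:R - (i == l)%:R) * z (inl (k, l))); last first.
      by rewrite pair_bigA; apply: eq_bigr => -[].
    transitivity (\sum_k \sum_l (supp k l * (i == k)%:R * z (inl (k, l))) -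
                  \sum_k \sum_l (supp k l * (i == l)%:R * z (inl (k, l)))).
      rewrite [X in _ - X]exchange_big /=.
      rewrite [X in X - _](bigD1 i) //= [X in _ + X - _]big1.
        rewrite [X in _ - X](bigD1 i) //= [X in _ - (_ + X)]big1.
          rewrite !addr0 -sumrB; apply: eq_bigr => l _.
          by rewrite !mxE eqxx [supp l i]suppC !mulr1 mulrBr.
        move=> k ki; apply: big1 => l _.
        by rewrite eq_sym (negPf ki) mulr0 mul0r.
      move=> k ki; apply: big1 => l _.
      by rewrite eq_sym (negPf ki) mulr0 mul0r.
    rewrite -sumrB; apply: eq_bigr => k _; rewrite -sumrB.
    by apply: eq_bigr => l _; ring.
  have C0 : C = 0.
    apply: lf; split; last first.
      by move=> k l; rewrite mxE mulf_eq0 pnatr_eq0 eqb0 negb_or negbK => /andP[].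
    split=> [k l|k l|k kP]; rewrite ?mxE.
    - by rewrite suppC; ring.
    - by rewrite mulf_eq0 pnatr_eq0 eqb0 negb_or negbK => /andP[/sQ].
    - by have := divC k; rewrite (negPf kP) mul0r addr0.
  rewrite big_sumType /= [X in _ + X]big1 ?addr0; last first.
    move=> k _; rewrite mulrAC.
    have := divC k; rewrite big1 ?add0r => [->|l _]; first by rewrite mul0r.
    by rewrite C0 mxE.
  transitivity (\sum_k \sum_l Q k l / kap k l * z (inl (k, l))).
    by rewrite pair_bigA; apply: eq_bigr => -[].
  set s := LHS.
  (* [C = 0] makes [z] symmetric on the support, whereas [Q / kap] is antisymmetric. *)
  suff : s = - s by lra.
  rewrite {1}/s exchange_big /= /s -sumrN; apply: eq_bigr => k _.
  rewrite -sumrN; apply: eq_bigr => l _.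
  have [Q0|Q0] := eqVneq (Q k l) 0; first by rewrite aQ Q0 oppr0 !mul0r oppr0.
  have -> : z (inl (k, l)) = z (inl (l, k)).
    have /eqP : C k l = 0 by rewrite C0 mxE.
    by rewrite mxE /supp Q0 mul1r subr_eq0 => /eqP.
  by rewrite (aQ k l) (kap_sym _ _ (sQ _ _ Q0)) !mulNr.
move=> p pE; exists p; split=> [k kP|k l Q0].
  have := pE (inr k); rewrite /= kP mul1r => ->.
  rewrite (bigD1 k) //= big1 ?addr0 ?eqxx ?mulr1 // => i ik.
  by rewrite (negPf ik) !mulr0.
have := pE (inl (k, l)); rewrite /= /supp Q0 /kap => ->.
under eq_bigr do rewrite mul1r mulrBr.
rewrite sumrB; congr (_ - _).
  by rewrite (bigD1 k) //= big1 ?addr0 ?eqxx ?mulr1 // => i /negPf->; rewrite mulr0.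
by rewrite (bigD1 l) //= big1 ?addr0 ?eqxx ?mulr1 // => i /negPf->; rewrite mulr0.
Qed.

(** Murray conductances vanish wherever [Q] does, so any other Kirchhoff flow differs from [Q] by a
    circulation on [Q], which is zero. *)
Lemma loop_free_physical Q : conserves (inflow B) Q -> loop_free Q ->
  kirchhoff_flow N B (murray c Q) Q /\ physical N B (murray c Q).
Proof.
move=> Qc lf; have [aQ sQ dQ] := Qc.
have cond := murray_conductances _ _ Qc.
have [p [pP pQ]] := loop_free_pressures _ _ Qc lf.
have flowE k l : (if adj N k l then (p k - p l) * murray c Q k l else 0) = Q k l.
  case: ifP => kl; last first.
    by apply/esym/eqP; apply: contraFT kl => /sQ.
  have [Q0|Q0] := eqVneq (Q k l) 0.
    by rewrite murray_eq0 ?mulr0.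
  by rewrite pQ // divfK // murray_neq0.
have flow : kirchhoff_flow N B (murray c Q) Q.
  exists p; last by apply/matrixP => k l; rewrite mxE flowE.
  split=> // k kP; rewrite -dQ // [LHS]big_mkcond.
  by apply: eq_bigr => l _; rewrite flowE.
split=> //; split=> //; exists Q; split=> // Q' flow'.
have [a' s' d'] := kirchhoff_conserves _ _ cond flow'.
apply/eqP; rewrite eq_sym -subr_eq0; apply/eqP; apply: lf; split.
  split=> [k l|k l|k kP].
  - by rewrite !mxE aQ a'; ring.
  - rewrite !mxE => h; have [Q0|/sQ//] := eqVneq (Q k l) 0.
    by apply: s'; apply: contraNneq h => ->; rewrite Q0 subrr.
  - by under eq_bigr do rewrite !mxE; rewrite sumrB d' // dQ // subrr.
move=> k l; rewrite !mxE; apply: contraNneq => Q0; rewrite Q0 subr0.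
case: flow' => p' _ ->; rewrite mxE; case: ifP => // kl.
by rewrite murray_eq0 ?mulr0.
Qed.

End Murray.

(** * Unit flows along paths, and uniqueness of paths *)

Fixpoint path_flow (k : 'I_V) (s : seq 'I_V) : 'M[R]_V :=
  if s is x :: s' then delta_mx k x - delta_mx x k + path_flow x s' else 0.

Lemma path_flow_anti k s i j : path_flow k s j i = - path_flow k s i j.
Proof.
elim: s k => [|x s IHs] k /=; first by rewrite !mxE oppr0.
by rewrite !mxE IHs [(j == k) && _]andbC [(j == x) && _]andbC; ring.
Qed.

(** The sum telescopes, leaving a unit source at the start and a unit sink at the end. *)
Lemma path_flow_div k s i :
  \sum_j path_flow k s i j = (i == k)%:R - (i == last k s)%:R.
Proof.
have sum_delta (a b : 'I_V) : \sum_j (delta_mx a b : 'M[R]_V) i j = (i == a)%:R.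
  rewrite (bigD1 b) //= big1 ?addr0 => [|j jb]; first by rewrite mxE eqxx andbT.
  by rewrite mxE (negPf jb) andbF.
elim: s k => [|x s IHs] k /=.
  by rewrite subrr big1 // => j _; rewrite mxE.
under eq_bigr do rewrite mxE [X in X + _]mxE [X in _ + X + _]mxE.
by rewrite !big_split /= sumrN !sum_delta IHs; ring.
Qed.

Lemma path_flow_supp kappa Q k s i j : (forall k l, Q l k = - Q k l) ->
  (forall k l, conducting N kappa k l -> Q k l != 0) ->
  path (conducting N kappa) k s -> path_flow k s i j != 0 -> Q i j != 0.
Proof.
move=> aQ kQ; elim: s k => [|x s IHs] k /=; first by rewrite mxE eqxx.
case/andP=> kx xs; rewrite !mxE.
have [/andP[/eqP-> /eqP->] _|_] := boolP ((i == k) && (j == x)); first exact: kQ.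
have [/andP[/eqP-> /eqP->] _|_] := boolP ((i == x) && (j == k)).
  by rewrite aQ oppr_eq0 kQ.
by rewrite subrr add0r; exact: IHs.
Qed.

Lemma path_flow_notin k s i j : i \notin k :: s -> path_flow k s i j = 0.
Proof.
elim: s k => [|x s IHs] k; first by rewrite /= mxE.
rewrite /= inE negb_or => /andP[/negPf ik ixs]; rewrite !mxE IHs // ik.
by move: ixs; rewrite inE negb_or => /andP[/negPf -> _]; rewrite subrr addr0.
Qed.

Lemma path_flow_head k x s j : uniq (k :: x :: s) ->
  path_flow k (x :: s) k j = (j == x)%:R.
Proof.
move=> /andP[kxs _]; rewrite /= !mxE path_flow_notin // eqxx /=.
move: kxs; rewrite inE negb_or => /andP[/negPf -> _].
by rewrite subr0 addr0.
Qed.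

Section Paths.
Variables (kappa Q : 'M[R]_V).
Hypotheses (aQ : forall k l, Q l k = - Q k l)
  (sQ : forall k l, Q k l != 0 -> adj N k l)
  (kQ : forall k l, conducting N kappa k l -> Q k l != 0)
  (lfQ : loop_free Q).

(** The unit flow along such a path balances off the pressure vertices, hence is a circulation; yet
    its net outflow at [k] is 1. *)
Lemma loop_free_no_pressure_path k l s : k \in pvert B -> l \in pvert B ->
  k != l -> ~ is_path N kappa k l s.
Proof.
move=> kP lP kl /and3P[ks _ /eqP sl].
have sup i j := path_flow_supp _ _ _ _ i j aQ kQ ks.
have F0 : path_flow k s = 0.
  apply: lfQ; split=> //; split=> [||i iP]; first exact: path_flow_anti.
    by move=> i j /sup /sQ.
  have iF x : x \in pvert B -> (i == x) = false.
    by move=> xP; apply: contraNF iP => /eqP ->.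
  by rewrite path_flow_div sl !iF // subrr.
have := path_flow_div k s k; rewrite F0 sl eqxx (negPf kl) big1 => [|j _].
  by move=> /esym/eqP; rewrite subr0 oner_eq0.
by rewrite mxE.
Qed.

(** Strip the common initial part. At the first divergence the difference of the two unit flows is a
    circulation with entry 1 on the step to [x], since a path leaves its start only once. *)
Lemma loop_free_path_unique k l s1 s2 :
  is_path N kappa k l s1 -> is_path N kappa k l s2 -> s1 = s2.
Proof.
have closed_path x y s : ~ is_path N kappa x x (y :: s).
  by move=> /and3P[_ /andP[xys _] /= /eqP lx]; rewrite -lx mem_last in xys.
elim: s1 k s2 => [|x s1 IHs] k [|y s2] //.
- by move=> /and3P[_ _ /eqP <-] /closed_path.
- by move=> + /and3P[_ _ /eqP kl]; rewrite -kl => /closed_path.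
move=> p1 p2; have [xy|xy] := eqVneq x y.
  move: p1 p2; rewrite -xy => /and3P[/andP[_ p1] /andP[_ u1] l1].
  move=> /and3P[/andP[_ p2] /andP[_ u2] l2].
  by congr (_ :: _); apply: (IHs x); apply/and3P.
case/and3P: p1 => p1 u1 /eqP l1; case/and3P: p2 => p2 u2 /eqP l2.
set P1 := path_flow k (x :: s1); set P2 := path_flow k (y :: s2).
have P12E i j : (P1 - P2) i j = P1 i j - P2 i j by rewrite mxE [X in _ + X]mxE.
have P12Q i j : (P1 - P2) i j != 0 -> Q i j != 0.
  rewrite P12E; have [->|h1 _] := eqVneq (P1 i j) 0.
    by rewrite add0r oppr_eq0; exact: (path_flow_supp _ _ _ _ _ _ aQ kQ p2).
  exact: (path_flow_supp _ _ _ _ _ _ aQ kQ p1).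
have F0 : P1 - P2 = 0.
  apply: lfQ; split=> //; split=> [i j|i j /P12Q /sQ//|i iP].
    by rewrite !P12E (path_flow_anti _ (x :: s1)) (path_flow_anti _ (y :: s2)); ring.
  under eq_bigr do rewrite P12E.
  by rewrite sumrB !path_flow_div l1 l2 subrr.
have := P12E k x; rewrite F0 /P1 /P2 !path_flow_head // eqxx (negPf xy) subr0 mxE.
by move/esym/eqP; rewrite oner_eq0.
Qed.

End Paths.
End Flows.

(** * Comparison of the minimizer with the Murray network of a loop-free flow *)

Theorem corollary3p10 (R : realType) (V : nat)
    (N : prior_network R V) (B : boundary_conditions R V) (K : R)
    (hK : 0 < K) (hF : fvert B != set0)
    (kappa Q : 'M[R]_V) (hmin : minimizes_dissipation N B K kappa Q) :
  [/\ (exists2 a : R, 0 < a &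
        forall k l : 'I_V, adj N k l ->
          kappa k l =
            a * (`|Q k l| `^ (4%:R / 3%:R)) / (weight N k l `^ (2%:R / 3%:R))),
      (forall k l : 'I_V, k != l -> forall s1 s2 : seq 'I_V,
          is_path N kappa k l s1 -> is_path N kappa k l s2 -> s1 = s2)
    & (forall k l : 'I_V, k \in pvert B -> l \in pvert B -> k != l ->
          ~ exists s : seq 'I_V, is_path N kappa k l s)].
Proof.
have [[cond _] flow mat minD] := hmin.
have Qc := kirchhoff_conserves _ _ _ _ cond flow.
have [aQ sQ _] := Qc.
have [Q' [Q'c lfQ' cost']] := loop_free_reduction _ _ _ _ Qc.
have S0 := transport_cost_gt0 _ _ _ Qc hF.
have S'0 := transport_cost_gt0 _ _ _ Q'c hF.
set S := transport_cost N Q in S0 cost'.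
set S' := transport_cost N Q' in S'0 cost'.
have leS : S' <= S by case: cost' => [/ltW|[->]].
(* With these constants the Murray networks of [Q] and [Q'] both use material [K]. *)
pose c := K / S; pose c' := K / S'.
have c0 : 0 < c by rewrite divr_gt0.
have c'0 : 0 < c' by rewrite divr_gt0.
have [flow' phys'] := loop_free_physical N B c' c'0 Q' Q'c lfQ'.
have := minD _ _ phys' flow'.
rewrite murray_material // murray_dissipation // -/S' => /(_ _)/wrap[].
  by rewrite divfK // gt_eqF.
have kapQ k l : adj N k l -> kappa k l = 0 -> Q k l = 0.
  by case: flow => p _ -> kl k0; rewrite mxE kl k0 mulr0.
have [leD eqD] := dissipation_bound N c c0 Q kappa cond kapQ.
move: leD eqD; rewrite mat -/S; set D := dissipation N kappa Q => leD eqD leD'.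
(* Both bounds become explicit: $S^3/K^2 \le D$ from Hoelder, and $D \le S'^3/K^2$ from
   minimality. *)
have lowE : 3%:R / c ^+ 2 * S = S ^+ 3 / K ^+ 2 + 2%:R / c ^+ 3 * K.
  by rewrite /c; field; rewrite !gt_eqF.
have upE : S' / c' ^+ 2 = S' ^+ 3 / K ^+ 2.
  by rewrite /c'; field; rewrite !gt_eqF.
have K2 : 0 < (K ^+ 2)^-1 by rewrite invr_gt0 exprn_gt0.
rewrite lowE lerD2r in leD; rewrite upE in leD'.
(* The two bounds exclude $S' < S$, so no cancellation took place. *)
have lfQ : loop_free N B Q.
  case: cost' => [ltS|[]//]; have := le_trans leD leD'.
  by rewrite leNgt ltr_pM2r // ltrXn2r // ltW.
have murrayP k l : adj N k l -> kappa k l = murray N c Q k l.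
  (* As $S' \le S$, the bounds coincide, and equality in Hoelder gives Murray's law on every
     edge. *)
  have eD : D = S ^+ 3 / K ^+ 2.
    apply/le_anti; rewrite leD andbT (le_trans leD') //.
    by rewrite ler_pM2r // lerXn2r // nnegrE ltW.
  move: eqD; rewrite lowE eD eqxx => /esym/forallP edgeP.
  have edgeE (i j : 'I_V) : (j < i)%N -> adj N i j -> kappa i j = murray N c Q i j.
    by move=> ji ij; apply/eqP; move: (edgeP (i, j)); rewrite /edge /= ji ij.
  move=> kl; case: (ltngtP k l) => [lt|lt|/ord_inj eq]; last 1 first.
  - by move: kl; rewrite eq adj_irr.
  - rewrite (cond _ _ kl).2 (murray_conductances _ _ _ _ _ Qc _ _ kl).2.
    by apply: edgeE; rewrite // adj_sym.
  - exact: edgeE.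
have kQ k l : conducting N kappa k l -> Q k l != 0.
  by case/andP=> kl; rewrite murrayP // lt_def => /andP[+ _]; rewrite murray_neq0.
split.
- exists (c ^+ 2); first by rewrite exprn_gt0.
  move=> k l kl; rewrite murrayP // murrayE powR_cbrt.
  have w0 := weight_gt0 kl.
  rewrite -[X in X `^ _](gtr0_norm w0) powR_cbrt.
  by field; rewrite gt_eqF ?cbrt_weight_gt0.
- move=> k l _ s1 s2; exact: loop_free_path_unique aQ sQ kQ lfQ _ _ _ _.
- move=> k l kP lP kl [s]; exact: loop_free_no_pressure_path aQ sQ kQ lfQ _ _ _ kP lP kl.
Qed.
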